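(* Let $p\in\mathbb{N}^*$. Assume that $\theta^{*,n}\to\theta^*$ as $n\to+\infty$ and that assumption [H-$p$] (that is, assumption [H-$k$] of the context with $k=p$) holds. Then $\theta^{*,n}-\theta^*$ has an expansion up to order $p$ in powers of $n^{-\alpha}$: there exist $C_1,\dots,C_p\in\mathbb{R}^d$ (independent of $n$) such that, as $n\to+\infty$, $$\theta^{*,n}-\theta^*=\frac{C_1}{n^{\alpha}}+\cdots+\frac{C_p}{n^{\alpha p}}+o\left(\frac{1}{n^{\alpha p}}\right).$$
   Context: Setting: $\alpha>0$ is fixed, $H:\mathbb{R}^d\times\mathbb{R}^q\to\mathbb{R}^d$, $U$ and $U^n$ ($n\in\mathbb{N}^*$) are $\mathbb{R}^q$-valued random vectors, $h(\theta):=\mathbb{E}[H(\theta,U)]$ and $h^n(\theta):=\mathbb{E}[H(\theta,U^n)]$ are functions from $\mathbb{R}^d$ to $\mathbb{R}^d$. The point $\theta^*$ is the zero of $h$ and $\theta^{*,n}$ is the zero of $h^n$, i.e. $h(\theta^* )=0$ and $h^n(\theta^{*,n})=0$. For $k\in\mathbb{N}^*$, assumption [H-$k$] is the following set of assumptions (all $o(\cdot)$ are as $n\to+\infty$, for fixed $\theta$): 1. For all $\theta\in\mathbb{R}^d$, $h(\theta)-h^n(\theta)=\frac{\Lambda^0_1(\theta)}{n^{\alpha}}+\cdots+\frac{\Lambda^0_k(\theta)}{n^{\alpha k}}+o(n^{-\alpha k})$, for some functions $\Lambda^0_j:\mathbb{R}^d\to\mathbb{R}^d$. 2. $h,h^n\in\mathcal{C}^k(\mathbb{R}^d,\mathbb{R}^d)$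 and, for all $1\le l\le k-1$ and all $\theta\in\mathbb{R}^d$, $D^lh^n(\theta)-D^lh(\theta)=\frac{\Lambda^l_1(\theta)}{n^{\alpha}}+\cdots+\frac{\Lambda^l_{k-l}(\theta)}{n^{\alpha(k-l)}}+o(n^{-\alpha(k-l)})$, where $\Lambda^l_1(\theta),\dots,\Lambda^l_{k-l}(\theta)$ and the remainder $o(n^{-\alpha(k-l)})$ are multilinear maps from $(\mathbb{R}^d)^l$ to $\mathbb{R}^d$. 3. For all $l\in\{1,\dots,k\}$, $(D^lh^n)_{n\ge1}$ converges locally uniformly to $D^lh$. 4. $Dh(\theta^* )$ is invertible. *)

(* Defs.v *)
From HB Require Import structures.
From mathcomp Require Import all_boot all_order all_algebra.
From mathcomp Require Import all_classical all_reals all_analysis.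
Set Implicit Arguments.
Unset Strict Implicit.
Unset Printing Implicit Defensive.
Import Order.TTheory GRing.Theory Num.Theory.
Import numFieldNormedType.Exports.
Local Open Scope classical_set_scope.
Local Open Scope ring_scope.

(* Vectors of R^d are row vectors 'rV[R]_d with the library's sup norm; the
   l-multilinear maps from (R^d)^l to R^d are functions on families indexed
   by 'I_l. *)
Section Multilinear.
Context {R : realType} {d : nat}.

Definition multimap (l : nat) : Type := ('I_l -> 'rV[R]_d) -> 'rV[R]_d.

(* [dfwith v x] is the family v with its entry at i replaced by x : 'rV[R]_d *)
Definition multilinear (l : nat) (m : multimap l) : Prop :=
  forall (v : 'I_l -> 'rV[R]_d) (i : 'I_l) (a : R) (x y : 'rV[R]_d),
    m (@dfwith _ (fun=> 'rV[R]_d) v i (a *: x + y)) =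
    a *: m (@dfwith _ (fun=> 'rV[R]_d) v i x)
      + m (@dfwith _ (fun=> 'rV[R]_d) v i y).

(* the operator norm of m is at most e *)
Definition opnorm_le (l : nat) (m : multimap l) (e : R) : Prop :=
  forall v : 'I_l -> 'rV[R]_d, `|m v| <= e * \prod_(i < l) `|v i|.

End Multilinear.
Arguments multimap : clear implicits.

Section HigherDerivatives.
Context {R : realType} {d : nat}.

(* D^l f (t) as a multilinear map:
   D^(l+1) f (t) (v_0, ..., v_l) = (D (D^l f) (t) v_0) (v_1, ..., v_l).
   As for 'd, the value is meaningful only where the derivatives exist. *)
Fixpoint iterD (l : nat) (f : 'rV[R]_d -> 'rV[R]_d) (t : 'rV[R]_d) {struct l} :
    multimap R d l :=
  match l return multimap R d l with
  | 0 => fun=> f t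
  | l'.+1 => fun v =>
      'd (fun s => @iterD l' f s (fun i => v (lift ord0 i))) t (v ord0)
  end.

(* the multilinear-map-valued function D^l f is Frechet differentiable at t
   for the operator norm *)
Definition iterD_differentiable (l : nat) (f : 'rV[R]_d -> 'rV[R]_d)
    (t : 'rV[R]_d) : Prop :=
  forall e : R, 0 < e -> \forall h \near (0 : 'rV[R]_d),
    opnorm_le (fun v : 'I_l -> 'rV[R]_d =>
      iterD f (t + h) v - iterD f t v - 'd (fun s => iterD f s v) t h)
      (e * `|h|).

Definition iterD_continuous (l : nat) (f : 'rV[R]_d -> 'rV[R]_d)
    (t : 'rV[R]_d) : Prop :=
  forall e : R, 0 < e -> \forall s \near t,
    opnorm_le (fun v : 'I_l -> 'rV[R]_d => iterD f s v - iterD f t v) e.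

Definition Ck (k : nat) (f : 'rV[R]_d -> 'rV[R]_d) : Prop :=
  (forall l : nat, (l < k)%N -> forall t, iterD_differentiable l f t) /\
  (forall l : nat, (l <= k)%N -> forall t, iterD_continuous l f t).

(* local uniform convergence, for the operator norm, of (D^l f_n) to D^l f *)
Definition iterD_cvg_loc_unif (l : nat) (fn : nat -> 'rV[R]_d -> 'rV[R]_d)
    (f : 'rV[R]_d -> 'rV[R]_d) : Prop :=
  forall t : 'rV[R]_d, exists2 A : set 'rV[R]_d, nbhs t A &
    forall e : R, 0 < e -> \forall n \near \oo, forall s, A s ->
      opnorm_le (fun v : 'I_l -> 'rV[R]_d => iterD (fn n) s v - iterD f s v) e.

End HigherDerivatives.

Section Assumption.
Context {R : realType} {d : nat}.

(* n^{-alpha j}; the value at n = 0 never matters *)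
Definition npow (alpha : R) (j n : nat) : R := (n%:R `^ (alpha * j%:R))^-1.

(* the o(n^{-alpha (k - l)}) in [HkD] is in operator norm *)
Record Hk (alpha : R) (h : 'rV[R]_d -> 'rV[R]_d)
    (hn : nat -> 'rV[R]_d -> 'rV[R]_d) (tstar : 'rV[R]_d) (k : nat) : Prop := {
  Hk0 : exists Lam : nat -> 'rV[R]_d -> 'rV[R]_d, forall t : 'rV[R]_d,
    (fun n => h t - hn n t
       - \sum_(1 <= j < k.+1) npow alpha j n *: Lam j t)
      =o_\oo (npow alpha k);
  Hk_smooth : Ck k h /\ (forall n : nat, (0 < n)%N -> Ck k (hn n));
  HkD : forall l : nat, (1 <= l <= k.-1)%N ->
    exists Lam : nat -> 'rV[R]_d -> multimap R d l, forall t : 'rV[R]_d,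
      (forall j : nat, (1 <= j <= k - l)%N -> multilinear (Lam j t)) /\
      (forall e : R, 0 < e -> \forall n \near \oo,
         opnorm_le (fun v => iterD (hn n) t v - iterD h t v
           - \sum_(1 <= j < (k - l).+1) npow alpha j n *: Lam j t v)
           (e * npow alpha (k - l) n));
  Hk_cvg : forall l : nat, (1 <= l <= k)%N -> iterD_cvg_loc_unif l hn h;
  Hk_inv : bijective ('d h tstar : 'rV[R]_d -> 'rV[R]_d)
}.

End Assumption.

Section Expectation.
Context {dT : measure_display} {T : measurableType dT} {R : realType}.
Variable P : probability T R.

(* measurability for the Borel sigma-algebra of R^q, coordinatewise *)
Definition random_vector (q : nat) (X : T -> 'rV[R]_q) : Prop :=
  forall i : 'I_q, measurable_fun setT (fun w => X w ord0 i).

Definition vec_integrable (d : nat) (X : T -> 'rV[R]_d) : Prop :=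
  forall i : 'I_d, P.-integrable setT (fun w => (X w ord0 i)%:E).

(* E[X]; meaningful when X is integrable *)
Definition vec_expectation (d : nat) (X : T -> 'rV[R]_d) : 'rV[R]_d :=
  \row_(i < d) fine ('E_P[fun w => X w ord0 i])%E.

End Expectation.

(* Main.v *)
Require Import Defs.
From HB Require Import structures.
From mathcomp Require Import all_boot all_order all_algebra.
From mathcomp Require Import all_classical all_reals all_analysis.
From mathcomp Require Import ring lra.
Set Implicit Arguments.
Unset Strict Implicit.
Unset Printing Implicit Defensive.
Import Order.TTheory GRing.Theory Num.Theory.
Import numFieldNormedType.Exports.
Local Open Scope classical_set_scope.
Local Open Scope ring_scope.

(** Put eps = n^(-alpha), write t and t_n for the zeros of h and hn, and let
eta = (t_n - t) / eps.  Taylor's formula of order p for hn at t, evaluated at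
the zero t_n = t + eps eta and divided by eps, reads

  Dh(t) eta = - hn(t) / eps - (Dhn(t) - Dh(t)) eta
              - sum_(2 <= l <= p) eps^(l-1) / l! D^l hn(t)(eta, ..., eta)
              + o(eps^(p-1)).

The remainder is o(|t_n - t|^p), because D^p hn is close to its value at t
uniformly in n near t ([iterD_hn_equicontinuous], [taylor_hn_tn]).  The same
formula at order 1 shows that eta is bounded ([eta_bounded]).

The rest is a bootstrap ([eta_expandsS]).  On the right-hand side, hn(t) / eps
has an expansion by hypothesis, and every occurrence of eta comes with a
coefficient which is itself expanded in powers of eps without constant term.
So an expansion of eta with m known terms gives an expansion of the
right-hand side with m + 1 known terms, and this passes to eta because Dh(t)
is invertible.  Boundedness of eta is the case m = 0, and the case m = p is
the theorem.  The hypotheses give D^l hn(t) only up to o(eps^(p-l)), but its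
coefficient eps^(l-1) makes this o(eps^(p-1)) for every l, so that the gain of
one order can be repeated until m = p.

The computation with expansions takes place in two classes of real sequences,
[expands] and [expands_noconst]: the first is an algebra, the second a module
over it, and the second is contained in the first with one order gained
([expands_noconst_expands]).  Multilinear terms are reduced to these by
developing them on the canonical basis ([expands_noconst_multilinear]). *)

(* The bare name is that of a lemma on iterated functions. *)
Local Notation iterD := Defs.iterD.

(** * Asymptotic expansions in powers of a vanishing scale *)

Section ExpansionScale.
Context {R : realType}.
Variable eps : nat -> R.
Hypothesis eps_gt0 : \forall n \near \oo, 0 < eps n.
Hypothesis eps_cvg0 : eps @ \oo --> 0.
Implicit Types (x y : nat -> R) (m : nat) (P : {poly R}).

Definition ev_bounded x := exists K : R, \forall n \near \oo, `|x n| <= K.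

Definition negligible m x := x =o_\oo (fun n => eps n ^+ m).

(** The factor [eps n] shifts the orders by one: [expands 0] is boundedness,
and [expands m.+1] is an expansion with error o(eps^m).  The degree of [P] is
left free, so that sums and products of expansions need no truncation. *)
Definition expands m x :=
  ev_bounded x /\ exists P, negligible m (fun n => eps n * (x n - P.[eps n])).

(** Expansions with zero constant term and error o(eps^m), the class of the
coefficients which raise the order of a product by one. *)
Definition expands_noconst m x :=
  exists P, negligible m (fun n => x n - eps n * P.[eps n]).

Lemma negligibleP m x : negligible m x <->
  forall e : R, 0 < e -> \forall n \near \oo, `|x n| <= e * eps n ^+ m.
Proof.
have epsN : \forall n \near \oo, `|eps n ^+ m| = eps n ^+ m.
  by apply: filterS eps_gt0 => n en; rewrite gtr0_norm ?exprn_gt0.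
split=> [/eqoP xo e e0|xo].
  by apply: filterS2 epsN (xo e e0) => n ->.
by apply/eqoP => e e0; apply: filterS2 epsN (xo e e0) => n ->.
Qed.

Lemma ev_bounded_near x y :
  (\forall n \near \oo, x n = y n) -> ev_bounded x -> ev_bounded y.
Proof.
by move=> xy [K xK]; exists K; near=> n; rewrite -(near xy n) //; near: n.
Unshelve. all: by end_near. Qed.

Lemma negligible_near m x y :
  (\forall n \near \oo, x n = y n) -> negligible m x -> negligible m y.
Proof.
move=> xy /negligibleP xo; apply/negligibleP => e e0; near=> n.
by rewrite -(near xy n) //; near: n; exact: xo.
Unshelve. all: by end_near. Qed.

Lemma ev_boundedD x y :
  ev_bounded x -> ev_bounded y -> ev_bounded (fun n => x n + y n).
Proof.
move=> [K xK] [L yL]; exists (K + L); near=> n.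
by rewrite (le_trans (ler_normD _ _)) // lerD //; near: n.
Unshelve. all: by end_near. Qed.

Lemma ev_boundedM x y :
  ev_bounded x -> ev_bounded y -> ev_bounded (fun n => x n * y n).
Proof.
move=> [K xK] [L yL]; exists (K * L); near=> n.
by rewrite normrM ler_pM //; near: n.
Unshelve. all: by end_near. Qed.

Lemma ev_bounded_cst (c : R) : ev_bounded (fun=> c).
Proof. by exists `|c|; near=> n. Unshelve. all: by end_near. Qed.

Lemma eps_le1 : \forall n \near \oo, eps n <= 1.
Proof.
have /cvgrPdist_lt /(_ 1 ltr01) eps1 := eps_cvg0.
near=> n; apply: le_trans (ler_norm _) _; apply: ltW.
by rewrite -[X in X < _]normrN -sub0r; near: n.
Unshelve. all: by end_near. Qed.

Lemma ev_bounded_eps : ev_bounded eps.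
Proof.
exists 1; near=> n; have en : 0 < eps n by near: n.
by rewrite gtr0_norm //; near: n; exact: eps_le1.
Unshelve. all: by end_near. Qed.

Lemma ev_bounded_horner P : ev_bounded (fun n => P.[eps n]).
Proof.
elim/poly_ind: P => [|P c IH].
  by apply: ev_bounded_near (ev_bounded_cst 0); near=> n; rewrite horner0.
apply: ev_bounded_near (ev_boundedD (ev_boundedM IH ev_bounded_eps)
  (ev_bounded_cst c)).
by near=> n; rewrite hornerMXaddC.
Unshelve. all: by end_near. Qed.

Lemma negligibleD m x y :
  negligible m x -> negligible m y -> negligible m (fun n => x n + y n).
Proof.
move=> /negligibleP xo /negligibleP yo; apply/negligibleP => e e0.
have e2 : 0 < e / 2 by rewrite divr_gt0.
near=> n; rewrite (le_trans (ler_normD _ _)) // [e]splitr mulrDl lerD //.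
  by near: n; exact: xo.
by near: n; exact: yo.
Unshelve. all: by end_near. Qed.

Lemma negligible_mul_bounded m x y :
  ev_bounded y -> negligible m x -> negligible m (fun n => y n * x n).
Proof.
move=> [K yK] /negligibleP xo; apply/negligibleP => e e0.
pose L := `|K| + 1; have L0 : 0 < L by rewrite ltr_wpDl.
have eL : 0 < e / L by rewrite divr_gt0.
near=> n; rewrite normrM -[e](mulrVK (unitf_gt0 L0)) mulrAC [leRHS]mulrC.
rewrite ler_pM //; last by near: n; exact: xo.
rewrite (@le_trans _ _ K) //; first by near: n.
by rewrite (le_trans (ler_norm _)) // lerDl.
Unshelve. all: by end_near. Qed.

Lemma negligible_eps0 : negligible 0 eps.
Proof.
apply/negligibleP => e e0; have /cvgrPdist_le /(_ e e0) ee := eps_cvg0.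
by near=> n; rewrite expr0 mulr1 -normrN -sub0r; near: n.
Unshelve. all: by end_near. Qed.

Lemma negligible_mul_eps m x :
  negligible m x -> negligible m.+1 (fun n => eps n * x n).
Proof.
move=> /negligibleP xo; apply/negligibleP => e e0; near=> n.
have en : 0 < eps n by near: n.
by rewrite normrM gtr0_norm // exprS mulrCA ler_pM2l //; near: n; exact: xo.
Unshelve. all: by end_near. Qed.

Lemma negligible_div_eps m x :
  negligible m.+1 x -> negligible m (fun n => x n / eps n).
Proof.
move=> /negligibleP xo; apply/negligibleP => e e0; near=> n.
have en : 0 < eps n by near: n.
rewrite normrM normfV (gtr0_norm en) ler_pdivrMr // -mulrA -exprSr.
by near: n; exact: xo.
Unshelve. all: by end_near. Qed.

Lemma negligible_mul_epsX m x k :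
  negligible m x -> negligible (m + k) (fun n => eps n ^+ k * x n).
Proof.
move=> xo; elim: k => [|k IH].
  by rewrite addn0; apply: negligible_near xo; near=> n; rewrite expr0 mul1r.
rewrite addnS; apply: negligible_near (negligible_mul_eps IH).
by near=> n; rewrite exprS mulrA.
Unshelve. all: by end_near. Qed.

Lemma negligible_epsX m : negligible m (fun n => eps n ^+ m.+1).
Proof.
apply: negligible_near (negligible_mul_epsX m negligible_eps0).
by near=> n; rewrite exprSr.
Unshelve. all: by end_near. Qed.

Lemma negligible_le m k x : (k <= m)%N -> negligible m x -> negligible k x.
Proof.
move=> km /negligibleP xo; apply/negligibleP => e e0; near=> n.
have en : 0 < eps n by near: n.
have e1 : eps n <= 1 by near: n; exact: eps_le1.
apply: (@le_trans _ _ (e * eps n ^+ m)); first by near: n; exact: xo.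
by rewrite ler_pM2l // ler_wiXn2l // ltW.
Unshelve. all: by end_near. Qed.

Lemma negligible_bounded m x : negligible m x -> ev_bounded x.
Proof.
move=> /(negligible_le (leq0n m)) /negligibleP /(_ 1 ltr01) x1.
exists 1; near=> n.
by rewrite -[leRHS]mulr1 -[X in _ * X](expr0 (eps n)); near: n.
Unshelve. all: by end_near. Qed.

Lemma expands_near m x y :
  (\forall n \near \oo, x n = y n) -> expands m x -> expands m y.
Proof.
move=> xy [xb [P xP]]; split; first exact: ev_bounded_near xb.
exists P; apply: negligible_near xP.
by near=> n; rewrite (near xy n).
Unshelve. all: by end_near. Qed.

Lemma expands_cst m (c : R) : expands m (fun=> c).
Proof.
split; first exact: ev_bounded_cst.
exists c%:P; apply: negligible_near
  (negligible_mul_bounded (ev_bounded_cst 0) (negligible_epsX m)).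
by near=> n; rewrite hornerC subrr mulr0 mul0r.
Unshelve. all: by end_near. Qed.

Lemma expandsD m x y :
  expands m x -> expands m y -> expands m (fun n => x n + y n).
Proof.
move=> [xb [P xP]] [yb [Q yQ]]; split; first exact: ev_boundedD.
exists (P + Q).
apply: negligible_near (negligibleD xP yQ).
by near=> n; rewrite hornerD; ring.
Unshelve. all: by end_near. Qed.

(** In x y - P Q = y (x - P) + P (y - Q), both differences get multiplied by
bounded sequences; this is why boundedness is part of [expands]. *)
Lemma expandsM m x y :
  expands m x -> expands m y -> expands m (fun n => x n * y n).
Proof.
move=> [xb [P xP]] [yb [Q yQ]]; split; first exact: ev_boundedM.
exists (P * Q).
apply: negligible_near (negligibleD (negligible_mul_bounded yb xP)
  (negligible_mul_bounded (ev_bounded_horner P) yQ)).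
by near=> n; rewrite hornerM; ring.
Unshelve. all: by end_near. Qed.

Lemma expandsN m x : expands m x -> expands m (fun n => - x n).
Proof.
move=> /(expandsM (expands_cst m (-1))); apply: expands_near.
by near=> n; rewrite mulN1r.
Unshelve. all: by end_near. Qed.

Lemma expands_sum m (I : Type) (r : seq I) (x : I -> nat -> R) :
  (forall i, expands m (x i)) -> expands m (fun n => \sum_(i <- r) x i n).
Proof.
move=> xE; elim: r => [|i r IH].
  by apply: expands_near (expands_cst m 0); near=> n; rewrite big_nil.
by apply: expands_near (expandsD (xE i) IH); near=> n; rewrite big_cons.
Unshelve. all: by end_near. Qed.

Lemma expands0 x : ev_bounded x -> expands 0 x.
Proof.
move=> xb; split=> //; exists 0.
apply: negligible_near (negligible_mul_bounded xb negligible_eps0).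
by near=> n; rewrite horner0 subr0 mulrC.
Unshelve. all: by end_near. Qed.

Lemma expands_negligible m x : negligible m x -> expands m.+1 x.
Proof.
move=> xo; split; first exact: negligible_bounded xo.
exists 0; apply: negligible_near (negligible_mul_eps xo).
by near=> n; rewrite horner0 subr0.
Unshelve. all: by end_near. Qed.

Lemma expands_le m k x : (k <= m)%N -> expands m x -> expands k x.
Proof.
by move=> km [xb [P xP]]; split=> //; exists P; exact: negligible_le xP.
Qed.

Lemma expands_noconst_near m x y :
  (\forall n \near \oo, x n = y n) ->
  expands_noconst m x -> expands_noconst m y.
Proof.
move=> xy [P xP]; exists P; apply: negligible_near xP.
by near=> n; rewrite (near xy n).
Unshelve. all: by end_near. Qed.

Lemma expands_noconst_le m k x :
  (k <= m)%N -> expands_noconst m x -> expands_noconst k x.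
Proof. by move=> km [P xP]; exists P; exact: negligible_le xP. Qed.

Lemma expands_noconstD m x y :
  expands_noconst m x -> expands_noconst m y ->
  expands_noconst m (fun n => x n + y n).
Proof.
move=> [P xP] [Q yQ]; exists (P + Q).
apply: negligible_near (negligibleD xP yQ).
by near=> n; rewrite hornerD; ring.
Unshelve. all: by end_near. Qed.

Lemma expands_noconst_eps_horner m P :
  expands_noconst m (fun n => eps n * P.[eps n]).
Proof.
exists P; apply: negligible_near
  (negligible_mul_bounded (ev_bounded_cst 0) (negligible_epsX m)).
by near=> n; rewrite subrr mul0r.
Unshelve. all: by end_near. Qed.

(** With x = eps P + r and y = Q + s, x y - eps P Q = r y + P (eps s): the
error s of y, which is only known through eps s, meets the factor eps. *)
Lemma expands_noconstM m x y :
  expands_noconst m x -> expands m y -> expands_noconst m (fun n => x n * y n).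
Proof.
move=> [P xP] [yb [Q yQ]]; exists (P * Q).
apply: negligible_near (negligibleD (negligible_mul_bounded yb xP)
  (negligible_mul_bounded (ev_bounded_horner P) yQ)).
by near=> n; rewrite hornerM; ring.
Unshelve. all: by end_near. Qed.

Lemma expands_noconst_sum m (I : Type) (r : seq I) (x : I -> nat -> R) :
  (forall i, expands_noconst m (x i)) ->
  expands_noconst m (fun n => \sum_(i <- r) x i n).
Proof.
move=> xE; elim: r => [|i r IH].
  apply: expands_noconst_near (expands_noconst_eps_horner m 0).
  by near=> n; rewrite big_nil horner0 mulr0.
apply: expands_noconst_near (expands_noconstD (xE i) IH).
by near=> n; rewrite big_cons.
Unshelve. all: by end_near. Qed.

Lemma expands_noconst_mul_eps m x :
  expands_noconst m x -> expands_noconst m.+1 (fun n => eps n * x n).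
Proof.
move=> [P xP]; exists (P * 'X); apply: negligible_near (negligible_mul_eps xP).
by near=> n; rewrite hornerMX; ring.
Unshelve. all: by end_near. Qed.

Lemma expands_noconst_mul_epsX m x k :
  expands_noconst m x -> expands_noconst (m + k) (fun n => eps n ^+ k * x n).
Proof.
move=> xE; elim: k => [|k IH].
  rewrite addn0; apply: expands_noconst_near xE.
  by near=> n; rewrite expr0 mul1r.
rewrite addnS; apply: expands_noconst_near (expands_noconst_mul_eps IH).
by near=> n; rewrite exprS mulrA.
Unshelve. all: by end_near. Qed.

(** The gain of one order on which the bootstrap rests. *)
Lemma expands_noconst_expands m x : expands_noconst m x -> expands m.+1 x.
Proof.
move=> [P xP]; split.
  apply: ev_bounded_near (ev_boundedD (negligible_bounded xP)
    (ev_boundedM ev_bounded_eps (ev_bounded_horner P))).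
  by near=> n; rewrite subrK.
exists (P * 'X); apply: negligible_near (negligible_mul_eps xP).
by near=> n; rewrite hornerMX; ring.
Unshelve. all: by end_near. Qed.

Lemma expands_div_eps m x :
  expands_noconst m.+1 x -> expands m.+1 (fun n => x n / eps n).
Proof.
move=> [P xP]; split.
  apply: ev_bounded_near (ev_boundedD
    (negligible_bounded (negligible_div_eps xP))
    (ev_bounded_horner P)).
  near=> n; have en : eps n != 0 by apply: lt0r_neq0; near: n.
  by field.
exists P; apply: negligible_near xP.
near=> n; have en : eps n != 0 by apply: lt0r_neq0; near: n.
by field.
Unshelve. all: by end_near. Qed.

(** Only the first m coefficients of the polynomial matter, since the others
contribute multiples of eps^m.+1 after the multiplication by eps. *)
Lemma expands_coeffs m x : expands m x -> exists c : nat -> R,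
  negligible m (fun n => eps n * x n - \sum_(1 <= j < m.+1) eps n ^+ j * c j).
Proof.
move=> [_ [P xP]]; exists (fun j => P`_j.-1).
apply: negligible_near (negligibleD xP (negligible_mul_bounded
  (ev_bounded_horner (drop_poly m P)) (negligible_epsX m))).
near=> n; rewrite -[P in P.[_]](poly_take_drop m).
rewrite hornerD hornerM hornerXn /take_poly horner_poly big_add1 /= big_mkord.
have -> : \sum_(j < m) eps n ^+ j.+1 * P`_j =
    eps n * \sum_(j < m) P`_j * eps n ^+ j.
  by rewrite mulr_sumr; apply: eq_bigr => j _; rewrite exprS; ring.
by rewrite exprS; ring.
Unshelve. all: by end_near. Qed.

Lemma expands_noconst_coeffs m x (c : nat -> R) :
  negligible m (fun n => x n - \sum_(1 <= j < m.+1) eps n ^+ j * c j) ->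
  expands_noconst m x.
Proof.
move=> xc; exists (\sum_(0 <= j < m) c j.+1 *: 'X^j).
apply: negligible_near xc; near=> n; congr (_ - _).
rewrite horner_sum big_add1 mulr_sumr /=; apply: eq_bigr => j _.
by rewrite hornerZ hornerXn exprS; ring.
Unshelve. all: by end_near. Qed.

End ExpansionScale.

(** * Taylor's formula along a segment *)

Section Taylor.
Context {R : realType}.

Definition taylor_poly (p : nat) (G : nat -> R -> R) : {poly R} :=
  \sum_(l < p.+1) (G l 0 / l`!%:R) *: 'X^l.

Lemma deriv_taylor_poly p (G : nat -> R -> R) :
  (taylor_poly p.+1 G)^`() = taylor_poly p (fun l => G l.+1).
Proof.
rewrite /taylor_poly raddf_sum big_ord_recl /= alg_polyC derivC add0r.
apply: eq_bigr => l _.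
rewrite derivZ derivXn /= add0n -scalerMnr -scaler_nat scalerA.
congr (_ *: _); rewrite factS natrM invfM; change (bump 0 l) with l.+1.
by rewrite mulrCA mulVKf ?pnatr_eq0.
Qed.

(** Induction on p: the derivative of [G 0] minus its Taylor polynomial is
the analogous difference for the shifted family, so the mean value theorem
turns a bound K c^p on it into K u^p.+1.  The factor 1 / p! is given up. *)
Lemma taylor_remainder p (G : nat -> R -> R) (b K : R) :
  (forall l u, (l < p)%N -> 0 <= u <= b -> is_derive u 1 (G l) (G l.+1 u)) ->
  (forall u, 0 <= u <= b -> `|G p u - G p 0| <= K) ->
  forall u, 0 <= u <= b -> `|G 0 u - (taylor_poly p G).[u]| <= K * u ^+ p.
Proof.
elim: p G => [|p IH] G dG GK u /andP[u0 ub].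
  rewrite /taylor_poly big_ord1 expr0 alg_polyC hornerC fact0 divr1 mulr1.
  by rewrite GK ?u0.
have [| |c cu] := @MVT_segment R (fun t => G 0 t - (taylor_poly p.+1 G).[t])
  (fun t => G 1 t - (taylor_poly p (fun l => G l.+1)).[t]) 0 u u0.
- move=> t; rewrite in_itv /= => /andP[t0 tu].
  rewrite -deriv_taylor_poly; apply: is_deriveB.
  by apply: dG => //; rewrite ltW // (le_trans (ltW tu)).
- apply: derivable_within_continuous => t; rewrite in_itv /= => /andP[t0 tu].
  apply: derivableB; last exact: derivable_horner.
  have [] // : is_derive t 1 (G 0) (G 1 t).
  by apply: dG; rewrite ?t0 ?(le_trans tu).
rewrite subr0 => rE.
have r0 : G 0 0 - (taylor_poly p.+1 G).[0] = 0.
  rewrite /taylor_poly horner_sum big_ord_recl big1 => [|l _].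
    by rewrite hornerZ hornerXn fact0 divr1 mulr1 addr0 subrr.
  by rewrite hornerZ hornerXn expr0n mulr0.
move: cu; rewrite in_itv /= => /andP[c0 cu].
move: rE; rewrite r0 subr0 => ->.
rewrite normrM (ger0_norm u0) exprSr mulrA ler_wpM2r //.
apply: (@le_trans _ _ (K * c ^+ p)).
  apply: (IH (fun l => G l.+1)); last by rewrite c0 (le_trans cu).
  - by move=> l t lp; apply: dG.
  - by move=> t; apply: GK.
rewrite ler_wpM2l ?lerXn2r ?nnegrE //.
by apply: le_trans (GK 0 _); rewrite ?lexx ?(le_trans u0 ub).
Qed.

End Taylor.

(** * Iterated differentials and multilinear maps *)

Section RowVectors.
Context {R : realType} {d : nat}.

Lemma coord_le_norm (x : 'rV[R]_d) i : `|x 0 i| <= `|x|.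
Proof.
rewrite [leRHS]/Num.Def.normr /= mx_normrE.
by apply/bigmax_geP; right; exists (0, i).
Qed.

Lemma norm_le_coord (x : 'rV[R]_d) (K : R) :
  0 <= K -> (forall i, `|x 0 i| <= K) -> `|x| <= K.
Proof.
move=> K0 xK; rewrite [leLHS]/Num.Def.normr /= mx_normrE; apply/bigmax_leP.
by split=> // -[i j] _; rewrite ord1.
Qed.

Lemma linear_bounded (f : 'rV[R]_d -> 'rV[R]_d) : linear f ->
  exists2 K, 0 < K & forall x, `|f x| <= K * `|x|.
Proof.
move=> fL; pose g := GRing.isLinear.Build _ _ _ _ _ fL.
pose F : {linear _ -> _} := HB.pack f g.
exists (1 + \sum_i `|f (delta_mx 0 i)|); first by rewrite ltr_wpDr ?sumr_ge0.
move=> x; rewrite -[f]/(F : _ -> _) {1}[x]row_sum_delta linear_sum.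
rewrite (le_trans (ler_norm_sum _ _ _)) // mulrDl mul1r ler_wpDl //.
rewrite mulr_suml; apply: ler_sum => i _.
by rewrite linearZ_LR normrZ mulrC ler_wpM2l // coord_le_norm.
Qed.

Lemma linear_continuous_rV (f : {linear 'rV[R]_d -> 'rV[R]_d}) : continuous f.
Proof.
have [K K0 fK] := linear_bounded (linearP f).
apply: bounded_linear_continuous; apply/linear_boundedP; near=> r => x.
by rewrite (le_trans (fK x)) // ler_wpM2r //; near: r; exact: nbhs_pinfty_ge.
Unshelve. all: by end_near. Qed.

End RowVectors.

Lemma diff_lincomb (K : numFieldType) (V W : normedModType K) (f g : V -> W)
    (t x : V) (a : K) :
  differentiable f t -> differentiable g t ->
  'd (fun s => a *: f s + g s) t x = a *: 'd f t x + 'd g t x.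
Proof.
move=> fD gD.
by rewrite (diffD (differentiableZ a fD) gD) fctE (diffZ a fD).
Qed.

Lemma is_diff_line (K : numFieldType) (V : normedModType K) (t x : V) (u : K) :
  is_diff u (fun s : K => t + s *: x) ( *:%R ^~ x).
Proof.
have -> : (fun s : K => t + s *: x) = cst t + ( *:%R ^~ x) by apply/funext.
rewrite -[X in is_diff_def _ _ X](add0r ( *:%R ^~ x : K -> V)).
exact: is_diffD.
Qed.

Lemma is_derive_comp_line (K : numFieldType) (V W : normedModType K)
    (g : V -> W) (t x : V) (u : K) : differentiable g (t + u *: x) ->
  is_derive u 1 (g \o (fun s : K => t + s *: x)) ('d g (t + u *: x) x).
Proof.
move=> gD; have line := is_diff_line t x u.
have gx : is_diff (t + u *: x) g ('d g (t + u *: x)) by exact: DiffDef.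
have gl := is_diff_comp line gx.
apply: DeriveDef; first exact: diff_derivable.
by rewrite deriveE // diff_val /= scale1r.
Qed.

Section IteratedDerivatives.
Context {R : realType} {d : nat}.
Implicit Types (f : 'rV[R]_d -> 'rV[R]_d) (t x : 'rV[R]_d).
Local Notation upd := (@dfwith _ (fun=> 'rV[R]_d)).

Lemma iterD_differentiable_at l f t (v : 'I_l -> 'rV[R]_d) :
  iterD_differentiable l f t -> differentiable (fun s => iterD f s v) t.
Proof.
move=> fD; apply/diff_locallyP; split; first exact: linear_continuous_rV.
apply/eqaddoP => e e0.
pose L := 1 + \prod_(i < l) `|v i|.
have L0 : 0 < L by rewrite ltr_wpDr // prodr_ge0.
have /fD : 0 < e / L by rewrite divr_gt0.
apply: filterS => u /(_ v); rewrite !fctE /= opprD addrA [u + t]addrC.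
move=> /le_trans; apply.
rewrite mulrAC ler_wpM2r // -mulrA ler_piMr ?(ltW e0) //.
by rewrite ler_pdivrMl // mulr1 lerDr.
Qed.

(** Linearity in the first slot is that of a differential.  In the other slots
it is inherited by induction, differentiation being linear on differentiable
maps; this is where smoothness enters. *)
Lemma iterD_multilinear k l f t :
  Ck k f -> (l <= k)%N -> multilinear (@iterD R d l f t).
Proof.
move=> [fD _]; elim: l t => [|l IH] t lk v i a x y; first by case: i.
case: (unliftP ord0 i) => [j ->|->] /=.
  have tail z : (fun i => upd v (lift ord0 j) z (lift ord0 i)) =
     upd (fun i => v (lift ord0 i)) j z.
    apply/funext => m; have [->|jm] := eqVneq j m; first by rewrite !dfwithin.
    by rewrite !dfwithout // (inj_eq lift_inj).
  rewrite !tail !dfwithout //.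
  set w := fun i => v (lift ord0 i).
  pose g z := fun s => iterD f s (upd w j z).
  have gD z : differentiable (g z) t.
    by apply: iterD_differentiable_at; apply: fD.
  rewrite -/(g (a *: x + y)) -/(g x) -/(g y).
  have -> : g (a *: x + y) = fun s => a *: g x s + g y s.
    by apply/funext => s; apply: IH; exact: ltnW.
  exact: diff_lincomb.
have tail z : (fun i => upd v ord0 z (lift ord0 i)) =
   fun i => v (lift ord0 i).
  by apply/funext => m; rewrite dfwithout.
by rewrite !tail !dfwithin linearP.
Qed.

(** Along a line of direction x, all the slots of D^l f are filled with x, so
that one more derivative fills one more slot with x. *)
Lemma is_derive_iterD_line k l f t x (u : R) i :
  Ck k f -> (l < k)%N ->
  is_derive u 1 (fun s : R => @iterD R d l f (t + s *: x) (fun=> x) 0 i)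
    (@iterD R d l.+1 f (t + u *: x) (fun=> x) 0 i).
Proof.
move=> [fD _] lk; set g := fun s => @iterD R d l f s (fun=> x).
have gD : differentiable g (t + u *: x).
  exact/iterD_differentiable_at/fD.
pose phi := g \o (fun s : R => t + s *: x).
have [phiD phi'E] := is_derive_comp_line gD.
apply: DeriveDef; first exact: (derivable_mxP phi u 1).1.
by move/rowP: (derive_mx phiD) => /(_ i); rewrite mxE phi'E => <-.
Qed.

Lemma taylor_iterD p f t x (b K : R) : 0 <= b -> Ck p f ->
  (forall u, 0 <= u <= b -> `|@iterD R d p f (t + u *: x) (fun=> x) -
     @iterD R d p f t (fun=> x)| <= K) ->
  `|f (t + b *: x) - \sum_(l < p.+1) (b ^+ l / l`!%:R) *:
     @iterD R d l f t (fun=> x)| <= K * b ^+ p.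
Proof.
move=> b0 fC fK.
have K0 : 0 <= K by apply: le_trans (fK 0 _); rewrite ?lexx.
apply: norm_le_coord => [|i]; first by rewrite mulr_ge0 ?exprn_ge0.
pose G l u := @iterD R d l f (t + u *: x) (fun=> x) 0 i.
have -> : (f (t + b *: x) - \sum_(l < p.+1) (b ^+ l / l`!%:R) *:
    @iterD R d l f t (fun=> x)) 0 i = G 0 b - (taylor_poly p G).[b].
  rewrite !mxE /taylor_poly horner_sum summxE; congr (_ - _).
  apply: eq_bigr => l _; rewrite mxE hornerZ hornerXn /G scale0r addr0.
  by rewrite [RHS]mulrC mulrA mulrAC.
apply: (@taylor_remainder _ p G b); last by rewrite b0 lexx.
- by move=> l u lp _; exact: is_derive_iterD_line fC lp.
- move=> u ub; apply: le_trans (fK u ub); apply: le_trans (coord_le_norm _ i).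
  by rewrite !mxE /G scale0r addr0.
Qed.

Lemma multilinear_expand_slot l (m : multimap R d l)
    (v : 'I_l -> 'rV[R]_d) k i :
  multilinear m ->
  m v 0 i = \sum_(b < d) m (upd v k (delta_mx 0 b)) 0 i * v k 0 b.
Proof.
move=> m_lin.
have FL : linear (fun x => m (upd v k x)) by move=> a x y; apply: m_lin.
pose F : {linear _ -> _} := HB.pack (fun x => m (upd v k x))
  (GRing.isLinear.Build _ _ _ _ _ FL).
have -> : m v = F (v k).
  congr m; apply/funext => j; have [->|jk] := eqVneq j k.
    by rewrite dfwithin.
  by rewrite dfwithout // eq_sym.
rewrite {1}[v k]row_sum_delta linear_sum summxE; apply: eq_bigr => b _.
by rewrite linearZ_LR mxE mulrC.
Qed.

(** Developing the slots one after the other on the canonical basis makes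
M n (v n) a sum of products of entries of M n by coordinates of v n. *)
Lemma expands_noconst_multilinear (eps : nat -> R) l m
    (M : nat -> multimap R d l) :
  (\forall n \near \oo, 0 < eps n) -> eps @ \oo --> 0 ->
  (\forall n \near \oo, multilinear (M n)) ->
  (forall (b : 'I_l -> 'I_d) i,
     expands_noconst eps m (fun n => M n (fun k => delta_mx 0 (b k)) 0 i)) ->
  forall v : nat -> 'I_l -> 'rV[R]_d,
  (forall k i, expands eps m (fun n => v n k 0 i)) ->
  forall i, expands_noconst eps m (fun n => M n (v n) 0 i).
Proof.
move=> eps_gt0 eps_cvg0 M_lin Mb v0 v0E i.
(* The slots from j on already hold basis vectors. *)
suff basis j : forall v : nat -> 'I_l -> 'rV[R]_d,
    (forall k i, expands eps m (fun n => v n k 0 i)) ->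
    (forall k : 'I_l, (j <= k)%N ->
       exists b, forall n, v n k = delta_mx 0 b) ->
    expands_noconst eps m (fun n => M n (v n) 0 i).
  by apply: (basis l) => // k; rewrite leqNgt ltn_ord.
elim: j => [|j IH] v vE vb.
  have [b bE] := choice (fun k => vb k (leq0n k)).
  apply: (expands_noconst_near eps_gt0 _ (Mb b i)); near=> n.
  have -> // : v n = fun k => delta_mx 0 (b k) by apply/funext => k.
have [lj|jl] := leqP l j.
  apply: IH => // k jk; apply: vb.
  by have := leq_trans lj jk; rewrite leqNgt ltn_ord.
pose k0 := Ordinal jl.
have Msum : \forall n \near \oo, \sum_(b < d)
    M n (upd (v n) k0 (delta_mx 0 b)) 0 i * v n k0 0 b = M n (v n) 0 i.
  by apply: filterS M_lin => n /multilinear_expand_slot <-.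
apply: (expands_noconst_near eps_gt0 Msum); apply: expands_noconst_sum => // b.
apply: expands_noconstM => //; apply: IH => [k a|k jk].
  have [->|kk0] := eqVneq k k0.
    apply: (expands_near eps_gt0 _ (expands_cst eps_gt0 eps_cvg0 m _)).
    by near=> n; rewrite dfwithin.
  apply: (expands_near eps_gt0 _ (vE k a)).
  by near=> n; rewrite dfwithout // eq_sym.
have [->|kk0] := eqVneq k k0.
  by exists b => n; rewrite dfwithin.
have [|c vc] := vb k; last by exists c => n; rewrite dfwithout // eq_sym.
by rewrite ltn_neqAle jk andbT eq_sym.
Unshelve. all: by end_near. Qed.

End IteratedDerivatives.

(** * The expansion of the perturbed zero *)
Section RootExpansion.
Context {R : realType} {d : nat}.
Variables (alpha : R) (h : 'rV[R]_d -> 'rV[R]_d).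
Variables (hn : nat -> 'rV[R]_d -> 'rV[R]_d) (tstar : 'rV[R]_d).
Variables (tn : nat -> 'rV[R]_d) (k : nat).
Hypothesis alpha_gt0 : 0 < alpha.
Hypothesis h_tstar : h tstar = 0.
Hypothesis hn_tn : forall n : nat, (0 < n)%N -> hn n (tn n) = 0.
Hypothesis tn_cvg : tn @ \oo --> tstar.
Hypothesis Hk_hn : Hk alpha h hn tstar k.+1.

Let eps := npow alpha 1.
Let delta n := tn n - tstar.
Let eta n := (eps n)^-1 *: delta n.

Lemma npowE j n : npow alpha j n = eps n ^+ j.
Proof.
by rewrite /eps /npow mulr1 powRrM powR_mulrn ?powR_ge0 // exprVn.
Qed.

Lemma eps_gt0 : \forall n \near \oo, 0 < eps n.
Proof.
by exists 1%N => // n /= n0; rewrite invr_gt0 powR_gt0 // ltr0n; exact: n0.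
Qed.

Lemma eps_cvg0 : eps @ \oo --> 0.
Proof.
apply/cvgrPdist_le => e e0; near=> n.
have en : 0 < eps n by near: n; exact: eps_gt0.
rewrite sub0r normrN gtr0_norm //.
rewrite /eps /npow mulr1 invf_ple ?posrE //; last first.
  by move: en; rewrite /eps /npow mulr1 invr_gt0.
have -> : e^-1 = (e^-1 `^ alpha^-1) `^ alpha.
  by rewrite -powRrM mulVf ?gt_eqF // powRr1 // invr_ge0 ltW.
apply: ge0_ler_powR; rewrite ?nnegrE ?powR_ge0 ?ler0n ?(ltW alpha_gt0) //.
by near: n; exact: nbhs_infty_ger.
Unshelve. all: by end_near. Qed.

Lemma multimap_coord_negligible l m (M : nat -> multimap R d l) v i :
  (forall e, 0 < e -> \forall n \near \oo, opnorm_le (M n) (e * eps n ^+ m)) ->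
  negligible eps m (fun n => M n v 0 i).
Proof.
move=> Mo; apply/(negligibleP eps_gt0) => e e0.
pose L := 1 + \prod_(i < l) `|v i|.
have L0 : 0 < L by rewrite ltr_wpDr // prodr_ge0.
have /Mo eL : 0 < e / L by rewrite divr_gt0.
apply: filterS2 eps_gt0 eL => n en /(_ v) ML.
apply: le_trans (coord_le_norm _ _) _; apply: le_trans ML _.
rewrite mulrAC ler_wpM2r ?exprn_ge0 ?(ltW en) // -mulrA ler_piMr ?(ltW e0) //.
by rewrite ler_pdivrMl // mulr1 lerDr.
Qed.

(** All the expansions of the hypotheses in one form: at l = k.+1, convergence
at t is an expansion without any term. *)
Lemma iterD_hn_expands l (v : 'I_l -> 'rV[R]_d) i : (l <= k.+1)%N ->
  expands_noconst eps (k.+1 - l)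
    (fun n => iterD (hn n) tstar v 0 i - iterD h tstar v 0 i).
Proof.
case: l v => [|l] v lk.
  have [Lam /(_ tstar) /eqoP LamE] := Hk0 Hk_hn.
  apply: (@expands_noconst_coeffs _ _ eps_gt0 _ _ (fun j => - Lam j tstar 0 i)).
  apply/(negligibleP eps_gt0) => e e0.
  apply: filterS2 eps_gt0 (LamE e e0) => n en.
  rewrite npowE ger0_norm ?exprn_ge0 ?(ltW en) // subn0; apply: le_trans.
  apply: le_trans (coord_le_norm _ i); rewrite -normrN !mxE summxE.
  rewrite le_eqVlt; apply/orP; left; apply/eqP; congr `|_|.
  have -> : \sum_(1 <= j < k.+2) eps n ^+ j * - Lam j tstar 0 i =
      - \sum_(1 <= j < k.+2) (npow alpha j n *: Lam j tstar) 0 i.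
    by rewrite -sumrN; apply: eq_bigr => j _; rewrite mxE npowE mulrN.
  by ring.
have [lk'|kl] := ltnP l k.
  have [|Lam /(_ tstar) [_ LamE]] := HkD Hk_hn (l := l.+1); first exact: lk'.
  apply: (@expands_noconst_coeffs _ _ eps_gt0 _ _ (fun j => Lam j tstar v 0 i)).
  apply: (negligible_near eps_gt0) (multimap_coord_negligible v i _);
    last first.
    by move=> e e0; apply: filterS (LamE e e0) => n; rewrite npowE; exact.
  near=> n; rewrite !mxE summxE; congr (_ - _).
  by apply: eq_bigr => j _; rewrite mxE npowE.
have lE : l = k by apply/eqP; rewrite eqn_leq kl andbT.
subst l.
have [A At Acvg] := Hk_cvg Hk_hn (l := k.+1) (leqnn _) tstar.
apply: (@expands_noconst_coeffs _ _ eps_gt0 _ _ (fun=> 0)); rewrite subnn.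
apply: (negligible_near eps_gt0) (multimap_coord_negligible v i _); last first.
  move=> e e0; apply: filterS (Acvg e e0) => n /(_ tstar (nbhs_singleton At)).
  by rewrite expr0 mulr1; exact.
by near=> n; rewrite big_geq // subr0 !mxE.
Unshelve. all: by end_near. Qed.

(** Three epsilons: D^l hn is uniformly close to D^l h near t, and D^l h is
continuous at t. *)
Lemma iterD_hn_equicontinuous l e : (1 <= l <= k.+1)%N -> 0 < e ->
  exists2 r : R, 0 < r & \forall n \near \oo, forall s, `|s - tstar| < r ->
    opnorm_le (fun v : 'I_l -> 'rV[R]_d =>
      iterD (hn n) s v - iterD (hn n) tstar v) e.
Proof.
move=> l1k e0; have [l1 lk] := andP l1k.
have e3 : 0 < e / 3 by rewrite divr_gt0.
have [A At Acvg] := Hk_cvg Hk_hn l1k tstar.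
have [[_ hC] _] := Hk_smooth Hk_hn.
have [r r0 rA] := (nbhs_normP _ _).1 (filterI At (hC l lk tstar (e / 3) e3)).
exists r => //; apply: filterS (Acvg _ e3) => n hnA s sr v.
have [sA hs] : A s /\ opnorm_le (fun v : 'I_l -> 'rV[R]_d =>
    iterD h s v - iterD h tstar v) (e / 3).
  by apply: rA; rewrite /= distrC.
have -> : iterD (hn n) s v - iterD (hn n) tstar v =
    (iterD (hn n) s v - iterD h s v) + (iterD h s v - iterD h tstar v)
    - (iterD (hn n) tstar v - iterD h tstar v).
  by rewrite addrA subrK opprB addrA subrK.
have -> : e = e / 3 + e / 3 + e / 3 by field.
rewrite !mulrDl; apply: le_trans (ler_normB _ _) _.
apply: lerD; last exact: (hnA _ (nbhs_singleton At)).
by apply: le_trans (ler_normD _ _) _; apply: lerD; [exact: hnA | exact: hs].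
Qed.

Lemma Ck_le (p q : nat) (f : 'rV[R]_d -> 'rV[R]_d) :
  (q <= p)%N -> Ck p f -> Ck q f.
Proof.
move=> qp [fD fC]; split=> l lq; first exact/fD/(leq_trans lq).
exact/fC/(leq_trans lq).
Qed.

(** The increment t_n - t is factored as b x in an arbitrary way: b = 1 serves
for the bound on [eta], and b = eps, x = eta for its expansion. *)
Lemma taylor_hn_tn q e : (1 <= q <= k.+1)%N -> 0 < e ->
  \forall n \near \oo, forall b x, 0 <= b -> b *: x = delta n ->
  `|\sum_(l < q.+1) (b ^+ l / l`!%:R) *:
     @iterD R d l (hn n) tstar (fun=> x)| <= e * (b * `|x|) ^+ q.
Proof.
move=> q1k e0; have [q1 qk] := andP q1k.
have [r r0 hnr] := iterD_hn_equicontinuous q1k e0.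
have tnr : \forall n \near \oo, `|tn n - tstar| < r.
  have /cvgrPdist_lt /(_ r r0) := tn_cvg.
  by apply: filterS => n; rewrite distrC.
have n_gt0 : \forall n \near \oo, (0 < n)%N by exists 1%N.
apply: filterS3 n_gt0 tnr hnr => n n0 tr hr b x b0 bx.
have hnC : Ck q (hn n) by apply: Ck_le qk _; exact: (Hk_smooth Hk_hn).2.
have -> : e * (b * `|x|) ^+ q = e * `|x| ^+ q * b ^+ q.
  by rewrite exprMn; ring.
have := @taylor_iterD R d q (hn n) tstar x b (e * `|x| ^+ q) b0 hnC.
rewrite bx subrKC hn_tn // sub0r normrN; apply => u /andP[u0 ub].
apply: le_trans (hr _ _ _) _.
  rewrite addrAC subrr add0r normrZ; apply: le_lt_trans tr.
  by rewrite -/(delta n) -bx normrZ ler_wpM2r // !ger0_norm.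
by rewrite prodr_const card_ord.
Qed.

Lemma ev_bounded_norm (w : nat -> 'rV[R]_d) :
  (forall i, ev_bounded (fun n => w n 0 i)) -> ev_bounded (fun n => `|w n|).
Proof.
move=> /choice[K wK]; exists (\sum_i `|K i|).
have : \forall n \near \oo, forall i, `|w n 0 i| <= K i.
  exact: filter_forall.
apply: filterS => n wn; rewrite normr_id; apply: norm_le_coord => [|i].
  exact: sumr_ge0.
apply: le_trans (wn i) _; apply: le_trans (ler_norm _) _.
by rewrite (bigD1 i) //= lerDl sumr_ge0.
Qed.

Lemma dh_inverse : exists B : {linear 'rV[R]_d -> 'rV[R]_d},
  cancel ('d h tstar) B.
Proof.
have [g hK Kh] := Hk_inv Hk_hn.
have gL : linear g := can2_linear hK Kh.
pose G : {linear 'rV[R]_d -> 'rV[R]_d} :=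
  HB.pack g (GRing.isLinear.Build _ _ _ _ _ gL).
by exists G.
Qed.

(** Taylor's formula at order 1 gives |Dh(t) delta| <= |hn(t)| + 2 e |delta|
for large n, and the last term is absorbed by the left-hand side once e is
small compared with the norm of the inverse of Dh(t).  Moreover
hn(t) = O(eps), as its expansion has no constant term. *)
Lemma eta_bounded i : ev_bounded (fun n => eta n 0 i).
Proof.
have [B hB] := dh_inverse; have [K K0 BK] := linear_bounded (linearP B).
pose w n := (eps n)^-1 *: hn n tstar.
have [M wM] : ev_bounded (fun n => `|w n|).
  apply: ev_bounded_norm => j.
  have [+ _] := expands_div_eps eps_gt0 eps_cvg0
    (@iterD_hn_expands 0 (fun=> 0) j isT).
  apply: ev_bounded_near; apply: nearW => n.
  by rewrite /= h_tstar !mxE subr0 mulrC.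
(* With this e, inverting Dh(t) turns 2 e |delta| into |delta| / 2. *)
pose e := (4 * K)^-1; have e0 : 0 < e by rewrite invr_gt0 mulr_gt0.
have [A At Acvg] := Hk_cvg Hk_hn (l := 1%N) isT tstar.
have T1 := @taylor_hn_tn 1%N e isT e0.
exists (2 * K * M).
apply: filterS (filterI (filterI eps_gt0 wM) (filterI (Acvg e e0) T1)).
move=> n [[en wn] [An Tn]].
have {}An := An tstar (nbhs_singleton At) (fun=> delta n).
have := Tn 1 (delta n) ler01 (scale1r _).
rewrite big_ord_recl big_ord1 !expr1n !expr1 !divr1 !mul1r !scale1r.
rewrite prodr_const card_ord expr1 in An => {}Tn.
set D := @iterD R d 1 (hn n) tstar (fun=> delta n) in An Tn.
have dh_le : `|'d h tstar (delta n)| <= `|hn n tstar| + 2 * e * `|delta n|.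
  have -> : 'd h tstar (delta n) =
      (hn n tstar + D) - (D - 'd h tstar (delta n)) - hn n tstar.
    by rewrite opprB -(addrA (hn n tstar)) subrKC addrAC subrr add0r.
  apply: le_trans (ler_normB _ _) _; rewrite addrC lerD2l.
  apply: le_trans (ler_normB _ _) _.
  have -> : 2 * e * `|delta n| = e * `|delta n| + e * `|delta n| by ring.
  exact: lerD.
have delta_le : `|delta n| <= 2 * K * `|hn n tstar|.
  have := BK ('d h tstar (delta n)); rewrite hB => dB.
  have {}dB := le_trans dB (ler_wpM2l (ltW K0) dh_le).
  have eK : K * (2 * e * `|delta n|) = `|delta n| / 2.
    by rewrite /e; field; rewrite gt_eqF.
  by move: dB; rewrite mulrDr eK -mulrA; lra.
apply: le_trans (coord_le_norm _ i) _.
rewrite normrZ; apply: le_trans (ler_wpM2l (normr_ge0 _) delta_le) _.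
rewrite mulrCA ler_wpM2l ?mulr_ge0 ?(ltW K0) //.
by move: wn; rewrite normr_id normrZ.
Qed.

Lemma multilinear_lincomb l (a b : R) (m1 m2 : multimap R d l) :
  multilinear m1 -> multilinear m2 ->
  multilinear (fun v => a *: m1 v + b *: m2 v).
Proof.
move=> m1L m2L v i c x y; rewrite m1L m2L !scalerDr !scalerA.
by rewrite [a * c]mulrC [b * c]mulrC addrACA.
Qed.

(** The term of degree l.+1 in Taylor's formula, divided by eps and without
its factorial; for l = 0, the part Dh(t), which stays on the left-hand side of
the equation for [eta], is taken away. *)
Definition correction l n : multimap R d l.+1 := fun v =>
  eps n ^+ l *: iterD (hn n) tstar v - (l == 0)%:R *: iterD h tstar v.
Arguments correction : clear implicits.

Lemma correction_multilinear l : (l <= k)%N ->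
  \forall n \near \oo, multilinear (correction l n).
Proof.
move=> lk; exists 1%N => // n n0.
have [hC hnC] := Hk_smooth Hk_hn.
rewrite /correction; under eq_fun do rewrite -scaleNr.
apply: multilinear_lincomb; first exact: iterD_multilinear (hnC n n0) _.
exact: iterD_multilinear hC _.
Qed.

(** The error o(eps^(k-l)) on D^l.+1 hn(t) is reduced to o(eps^k) by the
factor eps^l, whatever l.  There is no constant term: for l = 0 it has been
taken away, and for l > 0 the factor eps^l kills it. *)
Lemma correction_expands l v i : (l <= k)%N ->
  expands_noconst eps k (fun n => correction l n v 0 i).
Proof.
move=> lk; have := iterD_hn_expands v i (l := l.+1) lk.
rewrite subSS => /(expands_noconst_mul_epsX eps_gt0 l).
rewrite subnK // => hE.
have cE : expands_noconst eps k
    (fun n => (eps n ^+ l - (l == 0)%:R) * iterD h tstar v 0 i).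
  case: l {v lk hE} (iterD h tstar v 0 i) => [|l] c.
    apply: (expands_noconst_near eps_gt0 _
      (expands_noconst_eps_horner eps_gt0 eps_cvg0 k 0)).
    by apply: nearW => n; rewrite horner0 expr0 subrr mulr0 mul0r.
  apply: (expands_noconst_near eps_gt0 _
    (expands_noconst_eps_horner eps_gt0 eps_cvg0 k (c *: 'X^l))).
  apply: nearW => n; rewrite hornerZ hornerXn subr0 exprS; ring.
apply: (expands_noconst_near eps_gt0 _ (expands_noconstD eps_gt0 hE cE)).
by apply: nearW => n; rewrite !mxE mulrBr mulrBl addrA subrK.
Qed.

(** One step of the bootstrap: every coordinate of Dh(t) eta gains an order
from Taylor's formula, and [eta] is a fixed linear image of Dh(t) eta. *)
Lemma eta_expandsS m : (m < k.+1)%N ->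
  (forall i, expands eps m (fun n => eta n 0 i)) ->
  forall i, expands eps m.+1 (fun n => eta n 0 i).
Proof.
move=> mk etaE; have [B hB] := dh_inverse.
suff dhE j : expands eps m.+1 (fun n => 'd h tstar (eta n) 0 j).
  move=> i; have etaB n : eta n 0 i =
      \sum_j 'd h tstar (eta n) 0 j * B (delta_mx 0 j) 0 i.
    rewrite -{1}(hB (eta n)) {1}['d h tstar _]row_sum_delta linear_sum summxE.
    by apply: eq_bigr => j _; rewrite linearZ_LR mxE.
  apply: (expands_near eps_gt0 (x := fun n =>
    \sum_j 'd h tstar (eta n) 0 j * B (delta_mx 0 j) 0 i)).
    by apply: nearW => n; rewrite etaB.
  apply: (expands_sum eps_gt0 eps_cvg0) => j.
  apply: (expandsM eps_gt0 eps_cvg0 (dhE j)).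
  exact: (expands_cst eps_gt0 eps_cvg0).
(* S is the Taylor polynomial of hn at t, taken at t_n, where hn vanishes. *)
pose S n := \sum_(l < k.+2) (eps n ^+ l / l`!%:R) *:
  @iterD R d l (hn n) tstar (fun=> eta n).
have So : negligible eps k.+1 (fun n => S n 0 j).
  have [M etaM] := ev_bounded_norm eta_bounded.
  apply/(negligibleP eps_gt0) => e e0; pose L := 1 + `|M|.
  have L0 : 0 < L by rewrite ltr_wpDr.
  have e'0 : 0 < e / L ^+ k.+1 by rewrite divr_gt0 ?exprn_gt0.
  have k1 : (1 <= k.+1 <= k.+1)%N by rewrite leqnn.
  apply: filterS3 eps_gt0 etaM (taylor_hn_tn k1 e'0) => n en etaM T.
  apply: le_trans (coord_le_norm _ j) _.
  apply: le_trans (T (eps n) (eta n) (ltW en) _) _.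
    by rewrite /eta scalerA divff ?gt_eqF // scale1r.
  rewrite exprMn mulrCA [leRHS]mulrC ler_wpM2l ?exprn_ge0 ?(ltW en) //.
  rewrite -mulrA ler_piMr ?(ltW e0) // ler_pdivrMl ?exprn_gt0 // mulr1.
  rewrite lerXn2r ?nnegrE ?(ltW L0) //.
  move: etaM; rewrite normr_id => /le_trans; apply.
  by apply: le_trans (ler_norm _) _; rewrite lerDr.
have hn0 : expands eps m.+1 (fun n => hn n tstar 0 j / eps n).
  have := expands_div_eps eps_gt0 eps_cvg0
    (@iterD_hn_expands 0 (fun=> 0) j isT).
  move=> /(expands_le eps_gt0 eps_cvg0 mk); apply: (expands_near eps_gt0).
  by apply: nearW => n; rewrite /= h_tstar !mxE subr0.
have corrE (l : 'I_k.+1) : expands eps m.+1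
    (fun n => correction l n (fun=> eta n) 0 j / l.+1`!%:R).
  apply: (expandsM eps_gt0 eps_cvg0); last first.
    exact: (expands_cst eps_gt0 eps_cvg0).
  apply: (expands_noconst_expands eps_gt0 eps_cvg0).
  have lk : (l <= k)%N by rewrite -ltnS.
  apply: (expands_noconst_multilinear eps_gt0 eps_cvg0
    (correction_multilinear lk)) => // b i.
  apply: (expands_noconst_le eps_gt0 eps_cvg0 (m := k)) => //.
  exact: correction_expands.
have SE : expands eps m.+1 (fun n => S n 0 j / eps n).
  apply: (expands_le eps_gt0 eps_cvg0 mk).
  exact: (expands_negligible eps_gt0 eps_cvg0 (negligible_div_eps eps_gt0 So)).
have sumE := expands_sum eps_gt0 eps_cvg0 (index_enum _) corrE.
apply: (expands_near eps_gt0) (expandsD eps_gt0 SE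
  (expandsN eps_gt0 eps_cvg0 (expandsD eps_gt0 hn0 sumE))).
apply: filterS eps_gt0 => n en.
have -> : S n 0 j = hn n tstar 0 j + \sum_(l < k.+1)
    (eps n ^+ l.+1 / l.+1`!%:R) *
    @iterD R d l.+1 (hn n) tstar (fun=> eta n) 0 j.
  rewrite /S big_ord_recl expr0 divr1 scale1r mxE summxE; congr (_ + _).
  by apply: eq_bigr => l _; rewrite mxE.
rewrite mulrDl opprD addrACA subrr add0r mulr_suml -sumrB.
transitivity (\sum_(l < k.+1)
    ((l : nat) == 0)%:R * @iterD R d l.+1 h tstar (fun=> eta n) 0 j /
    l.+1`!%:R).
  have cancel_term (a b c f x y : R) : a != 0 -> f != 0 ->
      a * b / f * x / a - (b * x - c * y) / f = c * y / f.
    by move=> a0 f0; field; rewrite a0 f0.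
  apply: eq_bigr => l _; rewrite !mxE exprS.
  by apply: cancel_term; rewrite ?gt_eqF // pnatr_eq0 -lt0n fact_gt0.
rewrite big_ord_recl big1 => [|l _]; first by rewrite addr0 divr1 mul1r.
by rewrite !mul0r.
Qed.

Lemma eta_expands i : expands eps k.+1 (fun n => eta n 0 i).
Proof.
suff etaE m : (m <= k.+1)%N ->
  forall i, expands eps m (fun n => eta n 0 i) by exact: etaE.
elim: m => [_ j|m IH mk]; last first.
  by apply: eta_expandsS => //; apply: IH; exact: ltnW.
exact: (expands0 eps_gt0 eps_cvg0 (eta_bounded j)).
Qed.

Lemma root_expansion : exists C : nat -> 'rV[R]_d,
  (fun n => tn n - tstar - \sum_(1 <= j < k.+2) npow alpha j n *: C j)
    =o_\oo (npow alpha k.+1).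
Proof.
have /choice[c cP] := fun i => expands_coeffs eps_gt0 eps_cvg0 (eta_expands i).
exists (fun j => \row_i c i j); apply/eqoP => e e0.
have cN : \forall n \near \oo, forall i,
    `|eps n * eta n 0 i - \sum_(1 <= j < k.+2) eps n ^+ j * c i j|
    <= e * eps n ^+ k.+1.
  by apply: filter_forall => i; exact: (negligibleP eps_gt0 _ _).1 (cP i) e e0.
apply: filterS2 eps_gt0 cN => n en cn.
rewrite npowE ger0_norm ?exprn_ge0 ?(ltW en) //.
apply: norm_le_coord => [|i].
  by rewrite mulr_ge0 ?exprn_ge0 // ltW.
apply: le_trans (cn i); rewrite !mxE /= mulrA divff ?gt_eqF // mul1r.
rewrite summxE le_eqVlt; apply/orP; left; apply/eqP; congr `|_ - _|.
by apply: eq_bigr => j _; rewrite !mxE npowE.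
Qed.

End RootExpansion.

Theorem theorem2p1 (R : realType) (dT : measure_display)
    (T : measurableType dT) (P : probability T R) (d q : nat)
    (alpha : R) (alpha_gt0 : 0 < alpha)
    (H : 'rV[R]_d -> 'rV[R]_q -> 'rV[R]_d)
    (U : T -> 'rV[R]_q) (Un : nat -> T -> 'rV[R]_q)
    (U_rv : random_vector U)
    (Un_rv : forall n : nat, (0 < n)%N -> random_vector (Un n))
    (HU_int : forall t, vec_integrable P (fun w => H t (U w)))
    (HUn_int : forall n : nat, (0 < n)%N ->
       forall t, vec_integrable P (fun w => H t (Un n w)))
    (h : 'rV[R]_d -> 'rV[R]_d) (hn : nat -> 'rV[R]_d -> 'rV[R]_d)
    (hE : forall t, h t = vec_expectation P (fun w => H t (U w)))
    (hnE : forall n : nat, (0 < n)%N ->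
       forall t, hn n t = vec_expectation P (fun w => H t (Un n w)))
    (tstar : 'rV[R]_d) (tn : nat -> 'rV[R]_d)
    (h_tstar : h tstar = 0)
    (hn_tn : forall n : nat, (0 < n)%N -> hn n (tn n) = 0)
    (p : nat) (p_gt0 : (0 < p)%N)
    (tn_cvg : tn @ \oo --> tstar)
    (Hp : Hk alpha h hn tstar p) :
  exists C : nat -> 'rV[R]_d,
    (fun n => tn n - tstar - \sum_(1 <= j < p.+1) npow alpha j n *: C j)
      =o_\oo (npow alpha p).
Proof.
by case: p p_gt0 Hp => // k _ Hp; exact: root_expansion Hp.
Qed.
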